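(* Let $L$ be a distributive lattice, $I$ an ideal of $L$ with $I\ne L$, and $d$ a derivation on $L$, and suppose that $L$ is $\ker_I d$-atomic. The lattice $L/\theta_I^d$ is a Boolean algebra if and only if for each $x\in L$ there exists $y\in L$ such that $A_I^d(x)$ and $A_I^d(y)$ form a partition of $A_I^d(L)$ and $[y]_{\theta_I^d}$ is a complement of $[x]_{\theta_I^d}$ in $L/\theta_I^d$.
   Context: $L$ is not assumed bounded. An ideal of $L$ is a nonempty subset $I$ closed under $\vee$ such that $a\wedge x\in I$ whenever $a\in I$, $x\in L$. A derivation on $L$ is a map $d:L\to L$ with $d(x\wedge y)=(d(x)\wedge y)\vee(x\wedge d(y))$ and $d(x\vee y)=d(x)\vee d(y)$ for all $x,y$. Define $\ker_I d=\{x\in L\mid d(x)\in I\}$ (an ideal) and $(a)_I^d=\{x\in L\mid d(a\wedge x)\in I\}$. The relation $\theta_I^d$ is defined by $x\,\theta_I^d\,y$ iff $(x)_I^d=(y)_I^d$; it is a lattice congruence, and $L/\theta_I^d$ is the quotient lattice with classes $[x]_{\theta_I^d}$. For an ideal $J$, an element $a\in L\setminus J$ is a $J$-atom if $\{x\in L\mid x<a\}\subseteq J$, and $L$ is $J$-atomic if for each $a\in L\setminus J$ there is a $J$-atom $a_0\le a$. $A_I^d(L)$ is the set of all $\ker_I d$-atoms of $L$, and $A_I^d(x)=\{a\in A_I^d(L)\mid a\le x\}$. ''Partition'' means that the two sets are disjoint with union $A_I^d(L)$ (either may be empty). A complement of an element $u$ is an element $v$ such that $u\wedge v$ is the least element and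 $u\vee v$ is the greatest element of the lattice. A Boolean algebra is a bounded, complemented distributive lattice (the one-element lattice is allowed). *)

(* Defs.v *)
From HB Require Import structures.
From mathcomp Require Import all_boot all_order.
From mathcomp Require Import boolp classical_sets.

Set Implicit Arguments.
Unset Strict Implicit.
Unset Printing Implicit Defensive.

Import Order.TTheory.

Local Open Scope order_scope.
Local Open Scope quotient_scope.

Section LatticeNotions.
Context {disp : Order.disp_t} {L : latticeType disp}.
Implicit Types (x y z u v b t a : L) (J : set L).

Record ideal := Ideal {
  ideal_set :> L -> Prop;
  ideal_nonempty : exists x, ideal_set x;
  ideal_join : forall x y,
    ideal_set x -> ideal_set y -> ideal_set (Order.join x y);
  ideal_meet : forall a x, ideal_set a -> ideal_set (Order.meet a x) }.

Record derivation := Derivation {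
  deriv_fun :> L -> L;
  deriv_meet : forall x y,
    deriv_fun (Order.meet x y) =
    Order.join (Order.meet (deriv_fun x) y) (Order.meet x (deriv_fun y));
  deriv_join : forall x y,
    deriv_fun (Order.join x y) = Order.join (deriv_fun x) (deriv_fun y) }.

Definition is_least b := forall x, b <= x.

Definition is_greatest t := forall x, x <= t.

Definition is_complement u v :=
  is_least (Order.meet u v) /\ is_greatest (Order.join u v).

Definition is_atom_rel J a := ~ J a /\ forall x, x < a -> J x.

Definition is_atomic_rel J :=
  forall a, ~ J a -> exists a0, is_atom_rel J a0 /\ a0 <= a.

End LatticeNotions.

Arguments ideal {disp} L.
Arguments derivation {disp} L.

(* A predicate, rather than the structure ctbDistrLatticeType, because the
   bounds and the complementation are not given but asserted to exist. *)
Definition is_boolean_algebra {disp : Order.disp_t} (B : latticeType disp) :=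
  [/\ forall x y z : B,
        Order.meet x (Order.join y z) =
        Order.join (Order.meet x y) (Order.meet x z),
      exists b : B, is_least b,
      exists t : B, is_greatest t
    & forall u : B, exists v : B, is_complement u v].

Section DerivationQuotient.
Context {disp : Order.disp_t} {L : distrLatticeType disp}.
Variables (I : ideal L) (d : derivation L).

Definition kerI : set L := [set x | I (d x)].

Definition annI (a : L) : set L := [set x | I (d (Order.meet a x))].

Definition thetaI : rel L := fun x y => `[< annI x = annI y >].

Lemma thetaI_refl : reflexive thetaI.
Proof. by move=> x; apply/asboolP. Qed.

Lemma thetaI_sym : symmetric thetaI.
Proof. by move=> x y; apply/asboolP/asboolP => ->. Qed.

Lemma thetaI_trans : transitive thetaI.
Proof. by move=> y x z /asboolP xy /asboolP yz; apply/asboolP; rewrite xy. Qed.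

Canonical thetaI_equiv := EquivRel thetaI thetaI_refl thetaI_sym thetaI_trans.

Definition quotI := {eq_quot thetaI_equiv}.

HB.instance Definition _ := Choice.on quotI.
HB.instance Definition _ := Quotient.on quotI.
HB.instance Definition _ := EqQuotient.on quotI.

Definition classI (x : L) : quotI := \pi_quotI x.

Lemma classIP (x y : L) : classI x = classI y <-> annI x = annI y.
Proof.
split=> [/eqP|exy]; first by rewrite /classI piE => /asboolP.
by apply/eqP; rewrite /classI piE; apply/asboolP.
Qed.

Lemma classI_repr (x : L) : annI (repr (classI x)) = annI x.
Proof. by apply/classIP; rewrite /classI reprK. Qed.

Lemma ideal_joinE (x y : L) : I (Order.join x y) <-> I x /\ I y.
Proof.
split=> [Ixy|[Ix Iy]]; last exact: ideal_join.
by split; [rewrite -[x](joinKI y) | rewrite -[y](joinKI x) (joinC y)];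
  rewrite meetC; exact: ideal_meet.
Qed.

Lemma thetaI_meet (x x' y y' : L) : annI x = annI x' -> annI y = annI y' ->
  annI (Order.meet x y) = annI (Order.meet x' y').
Proof.
move=> exx' eyy'; apply/seteqP.
suff H u u' v v' : annI u = annI u' -> annI v = annI v' ->
    (annI (Order.meet u v) `<=` annI (Order.meet u' v'))%classic.
  by split; apply: H.
move=> eu ev a; rewrite /annI /= -meetA => Ha.
have : annI u (Order.meet v a) by [].
rewrite eu /annI /= meetCA => Hb.
have : annI v (Order.meet u' a) by [].
by rewrite ev /annI /= meetCA meetA.
Qed.

Lemma thetaI_join (x x' y y' : L) : annI x = annI x' -> annI y = annI y' ->
  annI (Order.join x y) = annI (Order.join x' y').
Proof.
move=> exx' eyy'.
have H u v : annI (Order.join u v) = (annI u `&` annI v)%classic.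
  apply/seteqP; rewrite /annI; split=> a /=; rewrite meetUl deriv_join.
    by move/ideal_joinE.
  by move=> uv; apply/ideal_joinE.
by rewrite !H exx' eyy'.
Qed.

Definition quotI_meet (p q : quotI) : quotI :=
  classI (Order.meet (repr p) (repr q)).

Definition quotI_join (p q : quotI) : quotI :=
  classI (Order.join (repr p) (repr q)).

Lemma quotI_meetE (x y : L) :
  quotI_meet (classI x) (classI y) = classI (Order.meet x y).
Proof. by apply/classIP; apply: thetaI_meet; exact: classI_repr. Qed.

Lemma quotI_joinE (x y : L) :
  quotI_join (classI x) (classI y) = classI (Order.join x y).
Proof. by apply/classIP; apply: thetaI_join; exact: classI_repr. Qed.

Lemma classI_surj (p : quotI) : exists x : L, p = classI x.
Proof. by exists (repr p); rewrite /classI reprK. Qed.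

Definition quotI_le (p q : quotI) : bool := quotI_meet p q == p.

Definition quotI_lt (p q : quotI) : bool := (q != p) && quotI_le p q.

Lemma quotI_meetC : commutative quotI_meet.
Proof. by move=> p q; rewrite /quotI_meet meetC. Qed.

Lemma quotI_joinC : commutative quotI_join.
Proof. by move=> p q; rewrite /quotI_join joinC. Qed.

Lemma quotI_meetA : associative quotI_meet.
Proof.
move=> p q r; have [x ->] := classI_surj p; have [y ->] := classI_surj q.
by have [z ->] := classI_surj r; rewrite !quotI_meetE meetA.
Qed.

Lemma quotI_joinA : associative quotI_join.
Proof.
move=> p q r; have [x ->] := classI_surj p; have [y ->] := classI_surj q.
by have [z ->] := classI_surj r; rewrite !quotI_joinE joinA.
Qed.

Lemma quotI_joinKI (q p : quotI) : quotI_meet p (quotI_join p q) = p.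
Proof.
have [x ->] := classI_surj p; have [y ->] := classI_surj q.
by rewrite quotI_joinE quotI_meetE joinKI.
Qed.

Lemma quotI_meetKU (q p : quotI) : quotI_join p (quotI_meet p q) = p.
Proof.
have [x ->] := classI_surj p; have [y ->] := classI_surj q.
by rewrite quotI_meetE quotI_joinE meetKU.
Qed.

Lemma quotI_meetUl : left_distributive quotI_meet quotI_join.
Proof.
move=> p q r; have [x ->] := classI_surj p; have [y ->] := classI_surj q.
have [z ->] := classI_surj r.
by rewrite quotI_joinE !quotI_meetE quotI_joinE meetUl.
Qed.

Lemma quotI_meetxx : idempotent_op quotI_meet.
Proof. by move=> p; have [x ->] := classI_surj p; rewrite quotI_meetE meetxx. Qed.

HB.instance Definition _ := Order.isMeetJoinDistrLattice.Build disp quotI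
  (fun _ _ => erefl) (fun _ _ => erefl)
  quotI_meetC quotI_joinC quotI_meetA quotI_joinA
  quotI_joinKI quotI_meetKU quotI_meetUl quotI_meetxx.

Lemma classI_meet (x y : L) :
  classI (Order.meet x y) = Order.meet (classI x) (classI y).
Proof. by rewrite -quotI_meetE. Qed.

Lemma classI_join (x y : L) :
  classI (Order.join x y) = Order.join (classI x) (classI y).
Proof. by rewrite -quotI_joinE. Qed.

Definition atomsI : set L := [set a | is_atom_rel kerI a].

Definition atomsI_below (x : L) : set L := [set a | atomsI a /\ a <= x].

End DerivationQuotient.

Definition is_partition2 {T : Type} (A B C : set T) :=
  (A `&` B = set0 /\ A `|` B = C)%classic.

(* Main.v *)
(* Membership in the ideal K = ker_I d depends only on the class modulo theta.
   So if [y] is a complement of [x], then x /\ y lies in K, while no K-atom a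
   has a /\ (x \/ y) in K.  The first fact excludes a K-atom below both x and
   y; by the second, a /\ x or a /\ y is outside K, and minimality of a puts a
   below x or y.  Hence the partition condition is automatic for complements. *)
Require Import Defs.
From mathcomp Require Import all_boot all_order.
From mathcomp Require Import boolp classical_sets.

Set Implicit Arguments.
Unset Strict Implicit.
Unset Printing Implicit Defensive.

Import Order.TTheory.

Local Open Scope order_scope.

Section KernelIdeal.
Context {disp : Order.disp_t} {L : distrLatticeType disp}.
Variables (I : ideal L) (d : derivation L).
Implicit Types x y a : L.

Lemma ideal_down x y : x <= y -> I y -> I x.
Proof. by move=> /meet_r <-; exact: ideal_meet. Qed.

Lemma deriv_homo x y : x <= y -> d x <= d y.
Proof. by move=> /join_r <-; rewrite deriv_join leUl. Qed.

Lemma kerI_down x y : x <= y -> kerI I d y -> kerI I d x.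
Proof. by move=> /deriv_homo; exact: ideal_down. Qed.

Lemma kerI_join x y : kerI I d x -> kerI I d y -> kerI I d (x `|` y).
Proof. by rewrite /kerI /= deriv_join; exact: ideal_join. Qed.

(** Expanding [d] at [x = x /\ x] gives [d x <= x], so every element of [I] lies in the kernel. *)
Lemma kerI_nonempty : exists x, kerI I d x.
Proof.
have [x Ix] := ideal_nonempty I; exists x; apply: ideal_down Ix.
by rewrite -{1}[x]meetxx deriv_meet leUx leIr leIl.
Qed.

(** For [x] in the kernel, [annI x] contains [y]; hence so does [annI y], which puts [y /\ y = y] in
    the kernel. *)
Lemma kerI_classI x y : classI I d x = classI I d y ->
  kerI I d x -> kerI I d y.
Proof.
move=> /classIP exy Kx; have : annI I d x y by exact: kerI_down (leIl _ _) Kx.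
by rewrite exy /annI /= meetxx.
Qed.

Lemma kerI_classI_le x y : classI I d x <= classI I d y ->
  kerI I d (x `&` y) -> kerI I d x.
Proof. by move=> /meet_l; rewrite -classI_meet; exact: kerI_classI. Qed.

(** A least class lies below the class of some kernel element [k], and [x /\ k] is in the kernel. *)
Lemma kerI_least x : is_least (classI I d x) -> kerI I d x.
Proof.
have [k Kk] := kerI_nonempty => /(_ (classI I d k)) /kerI_classI_le; apply.
exact: kerI_down (leIr _ _) Kk.
Qed.

Lemma atom_le a x : is_atom_rel (kerI I d) a -> ~ kerI I d (a `&` x) -> a <= x.
Proof.
move=> [_ minK] nK; apply: contra_notT nK => nax; apply: minK.
by rewrite lt_neqAle leIl andbT; apply: contra nax => /eqP <-; exact: leIr.
Qed.

Lemma complement_partition x y :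
  is_complement (classI I d x) (classI I d y) ->
  is_partition2 (atomsI_below I d x) (atomsI_below I d y) (atomsI I d).
Proof.
rewrite /is_complement -classI_meet -classI_join => -[/kerI_least Kxy topxy].
split; apply/seteqP; split=> a //.
- move=> [[[nKa _] ax] [_ ay]]; apply: nKa; apply: kerI_down Kxy.
  by rewrite lexI ax.
- by move=> [] [].
- move=> Aa; have [Kax|nKax] := pselect (kerI I d (a `&` x)); last first.
    by left; split=> //; exact: atom_le nKax.
  right; split=> //; apply: atom_le => // Kay.
  (* The class of [a] lies below the greatest class, that of [x \/ y], so [a] is in the kernel once
     [a /\ (x \/ y)] is. *)
  case: Aa => + _; apply; apply: (kerI_classI_le (topxy _)).
  by rewrite meetUr; exact: kerI_join.
Qed.

End KernelIdeal.

Theorem theorem4p10 (disp : Order.disp_t) (L : distrLatticeType disp)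
    (I : ideal L) (hI : ideal_set I <> [set: L]%classic) (d : derivation L)
    (hatomic : is_atomic_rel (kerI I d)) :
  is_boolean_algebra (quotI I d) <->
  forall x : L, exists y : L,
    is_partition2 (atomsI_below I d x) (atomsI_below I d y) (atomsI I d) /\
    is_complement (classI I d x) (classI I d y).
Proof.
split=> [[_ _ _ compl] x|compl].
  have [v] := compl (classI I d x); have [y ->] := classI_surj v => cxy.
  by exists y; split; first exact: complement_partition.
(* The bounds of the quotient are the meet and join of one complementary pair; any [x0] in [L]
   provides such a pair. *)
have [x0 _] := ideal_nonempty I; have [y0 [_ [bot top]]] := compl x0.
split; [exact: meetUr | by eexists; exact: bot | by eexists; exact: top |].
move=> u; have [x ->] := classI_surj u.
by have [y [_ cxy]] := compl x; exists (classI I d y).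
Qed.
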